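(* Let $A$ be a finite alphabet, let $p$ be a prime, and let $\mathfrak{M}=a(q-1)^d\in\mathbb{F}_p[q]$ with $d\ge 1$ an integer and $a\in\mathbb{F}_p$ non-zero. A language $L\subseteq A^*$ is a $p$-group language if and only if it is a Boolean combination of languages of the form $$L_{v,\mathfrak{R},\mathfrak{M}}=\left\{u\in A^*\;\middle|\; \binom{u}{v}_q\equiv \mathfrak{R}\pmod{\mathfrak{M}}\right\},$$ where $v\in A^*$ and $\mathfrak{R}\in\mathbb{F}_p[q]$ is a polynomial of degree less than $\deg(\mathfrak{M})$.
   Context: $A^*$ is the free monoid of finite words over $A$ (with concatenation and empty word $\varepsilon$), and $|w|$ is the length of a word $w$. The $q$-binomial coefficient $\binom{u}{v}_q\in\mathbb{N}[q]$ of two words $u,v\in A^*$ is defined recursively by $\binom{u}{\varepsilon}_q=1$, $\binom{\varepsilon}{v}_q=0$ if $v\neq\varepsilon$, and, for all $u,v\in A^*$ and letters $a,b\in A$, $\binom{ua}{vb}_q=q^{|vb|}\binom{u}{vb}_q+\delta_{a,b}\binom{u}{v}_q$, where $\delta_{a,b}$ is the Kronecker delta. For congruences modulo $\mathfrak{M}\in\mathbb{F}_p[q]$, the integer coefficients of $\binom{u}{v}_q$ are first reduced modulo $p$ to obtain an element of $\mathbb{F}_p[q]$, where $\mathbb{F}_p=\mathbb{Z}/p\mathbb{Z}$. A monoid $M$ recognizes a language $L\subseteq A^*$ if there exist a monoid morphism $\mu:A^*\to M$ and a subset $S\subseteq M$ with $L=\mu^{-1}(S)$. A $p$-group language is a language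 recognized by a finite $p$-group (a finite group whose order is a power of $p$, the trivial group being allowed). Boolean combinations are those obtained by finitely many unions, intersections and complements in $A^*$. *)

(* Defs.v *)
From HB Require Import structures.
From mathcomp Require Import all_boot all_order all_algebra all_fingroup.
From mathcomp Require Import all_solvable.
From mathcomp Require Import boolp classical_sets.

Set Implicit Arguments.
Unset Strict Implicit.
Unset Printing Implicit Defensive.

Local Open Scope classical_set_scope.
Local Open Scope ring_scope.

HB.instance Definition _ (A : choiceType) :=
  isMonoid.Build (seq A) (@catA A) (@cat0s A) (@cats0 A).

Section QBinomial.
Variable A : eqType.
Implicit Types u v : seq A.

(* The defining recursion removes the last letters of both words, whereas lists
   are consumed from the front: the recursion is run on the reversed words. *)
Fixpoint qbinomial_rev u v : {poly nat} :=
  match v, u with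
  | [::], _ => 1
  | _ :: _, [::] => 0
  | b :: v', a :: u' =>
      'X^(size v) * qbinomial_rev u' v + (a == b)%:R * qbinomial_rev u' v'
  end.

Definition qbinomial u v : {poly nat} := qbinomial_rev (rev u) (rev v).

Lemma qbinomialu0 u : qbinomial u [::] = 1.
Proof. by rewrite /qbinomial; case: (rev u). Qed.

Lemma qbinomial0v v : v != [::] -> qbinomial [::] v = 0.
Proof. by case/lastP: v => // v b _; rewrite /qbinomial rev_rcons. Qed.

Lemma qbinomial_rcons u v a b :
  qbinomial (rcons u a) (rcons v b) =
    'X^(size (rcons v b)) * qbinomial u (rcons v b)
    + (a == b)%:R * qbinomial u v.
Proof. by rewrite /qbinomial !rev_rcons /= size_rev size_rcons. Qed.

End QBinomial.

Definition qbinomialFp (A : eqType) (p : nat) (u v : seq A) : {poly 'F_p} :=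
  map_poly (fun n : nat => n%:R) (qbinomial u v).

Definition qbinomial_language (A : eqType) (p : nat)
    (v : seq A) (R M : {poly 'F_p}) : set (seq A) :=
  [set u | qbinomialFp p u v %% M = R %% M].

Definition recognizes (A : choiceType) (M : monoidType) (L : set (seq A)) :=
  exists (mu : seq A -> M) (S : set M),
    monoid.monoid_morphism mu /\ L = mu @^-1` S.

Definition p_group_language (A : choiceType) (p : nat) (L : set (seq A)) :=
  exists gT : finGroupType, (p.-group [set: gT]%G)%g /\ recognizes gT L.

Inductive boolean_combination (T : Type) (F : set (set T)) : set T -> Prop :=
| BoolComb_base X : F X -> boolean_combination F X
| BoolComb_setU X Y : boolean_combination F X -> boolean_combination F Y ->
    boolean_combination F (X `|` Y)
| BoolComb_setI X Y : boolean_combination F X -> boolean_combination F Y ->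
    boolean_combination F (X `&` Y)
| BoolComb_setC X : boolean_combination F X -> boolean_combination F (~` X).

(* Main.v *)
(* Congruence modulo M amounts to congruence modulo (q - 1)^d.

   The function u |-> binom(u, vb)_q mod (q - 1)^d satisfies
   f(ua) = q^|vb| f(u) + delta_{a,b} binom(u, v)_q.  As q is a p-power root of
   unity modulo (q - 1)^d, such a recursion extends a p-group recognizing
   binom(., v)_q by an abelian p-group; induction on v gives one direction.

   Conversely, let mu : A* -> G with G a p-group.  The augmentation ideal of
   F_p[G] is nilpotent, so every function phi o mu to F_p is killed by long
   products of the difference operators f |-> (u |-> f(ua) - f(u)).  By Newton
   interpolation, it is a finite linear combination of the binomials
   binom(u, v) mod p, and these are the values at q = 1 of the residues of
   binom(u, v)_q modulo M. *)
Require Import Defs.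
From mathcomp Require Import all_boot all_order all_algebra all_fingroup.
From mathcomp Require Import all_solvable all_character.
From mathcomp Require Import boolp classical_sets.

Set Implicit Arguments.
Unset Strict Implicit.
Unset Printing Implicit Defensive.

Import GRing.Theory.

Local Open Scope classical_set_scope.
Local Open Scope ring_scope.

(** * Functions on words factoring through finite [p]-groups *)

Definition p_group_function (A : choiceType) (p : nat) (T : Type)
    (f : seq A -> T) :=
  exists (gT : finGroupType) (mu : seq A -> gT) (phi : gT -> T),
    [/\ (p.-group [set: gT]%G)%g, monoid.monoid_morphism mu & f =1 phi \o mu].

(** Languages are the case [T = Prop], so Boolean operations become pairing followed by composition
    with a connective. *)
Lemma p_group_languageE (A : choiceType) (p : nat) (L : set (seq A)) :
  p_group_language p L <-> p_group_function p L.
Proof.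
split=> [[gT [pG [mu [S [muM ->]]]]]|[gT [mu [phi [pG muM Lmu]]]]].
  by exists gT, mu, S; split.
exists gT; split=> //; exists mu, phi; split=> //.
by apply/funext => u; rewrite Lmu.
Qed.

Section PGroupFunctions.
Variables (A : choiceType) (p : nat).

Lemma p_group_function_comp (T1 T2 : Type) (h : T1 -> T2) (f : seq A -> T1) :
  p_group_function p f -> p_group_function p (h \o f).
Proof.
case=> gT [mu [phi [pG muM fE]]]; exists gT, mu, (h \o phi); split=> // u.
by rewrite /= fE.
Qed.

Lemma p_group_function_cst (T : Type) (c : T) :
  p_group_function p (fun _ : seq A => c).
Proof.
exists 'S_0, (fun=> 1%g), (fun=> c); split=> //; last first.
  by split=> // u v; rewrite mulg1.
by rewrite /pgroup cardsT card_Sn.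
Qed.

Lemma p_group_function_pair (T1 T2 : Type) (f1 : seq A -> T1)
    (f2 : seq A -> T2) :
  p_group_function p f1 -> p_group_function p f2 ->
  p_group_function p (fun u => (f1 u, f2 u)).
Proof.
case=> gT1 [mu1 [phi1 [pG1 mu1M f1E]]] [gT2 [mu2 [phi2 [pG2 mu2M f2E]]]].
exists (gT1 * gT2)%type, (fun u => (mu1 u, mu2 u)),
  (fun x => (phi1 x.1, phi2 x.2)).
split; last by move=> u; rewrite /= f1E f2E.
- move: pG1 pG2; rewrite /pgroup !cardsT card_prod => pG1 pG2.
  by rewrite pnatM pG1.
- by split=> [|u v]; rewrite ?mu1M ?mu2M //.
Qed.

(** Words permute the states, and the permutations so obtained form a finite monoid, hence a group.
    Its exponent divides [p ^ m], so it is a [p]-group. *)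
Lemma p_group_function_foldl (X : finType) (step : X -> A -> X) (m : nat)
    (x0 : X) :
    prime p ->
    (forall w x, iter (p ^ m) (fun y => foldl step y w) x = x) ->
  p_group_function p (foldl step x0).
Proof.
move=> p_pr stepK.
have stepI a : injective (step^~ a).
  have pm_gt0 : (0 < p ^ m)%N by rewrite expn_gt0 prime_gt0.
  move=> x y /= eq_xy; rewrite -(stepK [:: a] x) -(stepK [:: a] y).
  by rewrite -(prednK pm_gt0) !iterSr /= eq_xy.
pose mu0 (u : seq A) : {perm X} := (\prod_(a <- u) perm (@stepI a))%g.
have mu0M u v : mu0 (u ++ v) = (mu0 u * mu0 v)%g by rewrite /mu0 big_cat.
have mu0E u x : mu0 u x = foldl step x u.
  elim: u x => [|a u IHu] x; first by rewrite /mu0 big_nil perm1.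
  by rewrite -cat1s mu0M permM IHu /= /mu0 big_seq1 permE.
pose H := [set s : {perm X} | `[< exists u, s = mu0 u >]]%SET.
have HP s : reflect (exists u, s = mu0 u) (s \in H).
  by rewrite inE; apply: asboolP.
have gH : group_set H.
  apply/group_setP; split; first by apply/HP; exists [::]; rewrite /mu0 big_nil.
  by move=> _ _ /HP[u ->] /HP[v ->]; apply/HP; exists (u ++ v).
pose G := Group gH.
have GE u : mu0 u \in G by apply/HP; exists u.
have pG : p.-group%g G.
  rewrite -pnat_exponent; apply: (@pnat_dvd _ (p ^ m)).
    apply/exponentP => _ /HP[u ->]; apply/permP => x; rewrite permX perm1.
    by rewrite -[RHS](stepK u); apply: eq_iter => y; apply: mu0E.
  by rewrite pnatX pnat_id.
exists (subg_of G), (fun u => subg G (mu0 u)),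
  (fun s => (sgval s : {perm X}) x0).
split=> [||u].
- by rewrite /pgroup -(card_isog (isog_subg G)).
- split=> [|u v]; first by rewrite /mu0 big_nil -[RHS]sgvalK.
  by rewrite mu0M subgM.
- by rewrite /= subgK // mu0E.
Qed.

(* The automaton on [G * V] implementing the recursion is a wreath-product-like
   extension of the [p]-group [G] by [V]: after [p ^ m] rounds of a word it acts
   by a mere translation in [V], which [p] further repetitions kill. *)
Lemma p_group_function_recursion (V : finZmodType) (T : Type)
    (theta : V -> V) (k : nat) (f : seq A -> V) (g : seq A -> T)
    (gamma : A -> T -> V) :
    prime p -> {morph theta : x y / x + y} -> (forall x : V, x *+ p = 0) ->
    iter (p ^ k) theta =1 id ->
    p_group_function p g ->
    (forall u a, f (rcons u a) = theta (f u) + gamma a (g u)) ->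
  p_group_function p f.
Proof.
move=> p_pr thetaD charV thetaK [gT [mu [phi [pG muM gE]]]] fE.
have [n oG] := p_natP pG.
pose step (x : gT * V) a :=
  ((x.1 * mu [:: a])%g, theta x.2 + gamma a (phi x.1)).
have mu_rcons u a : mu (rcons u a) = (mu u * mu [:: a])%g.
  by rewrite -cats1 -muM.
have fstE u x : (foldl step x u).1 = (x.1 * mu u)%g.
  elim/last_ind: u => [|u a IHu] /=; first by rewrite muM mulg1.
  by rewrite foldl_rcons /= IHu mu_rcons mulgA.
have runE u : foldl step (1%g, f [::]) u = (mu u, f u).
  elim/last_ind: u => [|u a IHu] /=; first by rewrite muM.
  by rewrite foldl_rcons IHu /step /= -mu_rcons fE gE.
have sndE u y : exists c, forall z,
    (foldl step (y, z) u).2 = iter (size u) theta z + c.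
  elim/last_ind: u => [|u a [c cE]]; first by exists 0 => z; rewrite addr0.
  exists (theta c + gamma a (phi (y * mu u)%g)) => z.
  by rewrite foldl_rcons /= fstE cE size_rcons /= thetaD addrA.
(* In the exponent, [p ^ n] trivializes the group component, [p ^ k] removes the power of [theta],
   and the last factor [p] kills the remaining translation. *)
suff stepK w x : iter (p ^ (n + k).+1) (fun y => foldl step y w) x = x.
  have := p_group_function_foldl (1%g, f [::]) p_pr stepK.
  move/(p_group_function_comp snd); congr p_group_function.
  by apply/funext => u /=; rewrite runE.
have iterE j y : iter j (fun y => foldl step y w) y =
    foldl step y (flatten (nseq j w)).
  by elim: j y => // j IHj y; rewrite iterSr IHj -foldl_cat.
have muX j : mu (flatten (nseq j w)) = (mu w ^+ j)%g.
  elim: j => [|j IHj] /=; first by rewrite muM.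
  by rewrite expgS -IHj -muM.
set N := (p ^ (n + k))%N.
have muN : (mu w ^+ N)%g = 1%g.
  rewrite /N expnD expgM.
  have -> : (p ^ n)%N = #|[set: gT]%G| by rewrite oG.
  by rewrite expg_cardG ?inE // expg1n.
have iter_theta j : iter (p ^ k * j) theta =1 id.
  by elim: j => [|j IHj] z; rewrite ?muln0 // mulnS iterD IHj thetaK.
have [c cE] := sndE (flatten (nseq N w)) x.1.
have NE z : iter N (fun y => foldl step y w) (x.1, z) = (x.1, z + c).
  rewrite iterE [LHS]surjective_pairing fstE cE /= muX muN mulg1.
  rewrite size_flatten /shape map_nseq sumn_nseq.
  have -> : (size w * N = p ^ k * (p ^ n * size w))%N.
    by rewrite /N expnD mulnA [RHS]mulnC [(size w * _)%N]mulnC.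
  by rewrite iter_theta.
have pNE j z :
    iter (j * N) (fun y => foldl step y w) (x.1, z) = (x.1, z + c *+ j).
  elim: j z => [|j IHj] z; first by rewrite addr0.
  by rewrite mulSn addnC iterD NE IHj mulrS addrA.
by rewrite expnS -/N {1}[x]surjective_pairing pNE charV addr0
  -surjective_pairing.
Qed.

End PGroupFunctions.

(** * [q]-binomial coefficients reduced modulo [p] *)

Section QBinomialFp.
Variables (A : eqType) (p : nat).

Lemma qbinomialFpu0 (u : seq A) : qbinomialFp p u [::] = 1.
Proof. by rewrite /qbinomialFp qbinomialu0 rmorph1. Qed.

Lemma qbinomialFp0v (v : seq A) : v != [::] -> qbinomialFp p [::] v = 0.
Proof. by move=> v_neq0; rewrite /qbinomialFp qbinomial0v // rmorph0. Qed.

Lemma qbinomialFp_rcons (u v : seq A) (a b : A) :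
  qbinomialFp p (rcons u a) (rcons v b) =
    'X^(size (rcons v b)) * qbinomialFp p u (rcons v b)
    + (a == b)%:R * qbinomialFp p u v.
Proof.
rewrite /qbinomialFp qbinomial_rcons rmorphD !rmorphM /=.
by rewrite map_polyXn rmorph_nat.
Qed.
End QBinomialFp.

(** * Residues modulo a power of [q - 1] *)

Section Residues.
Variables (p d : nat).
Hypotheses (p_prime : prime p) (d_ge1 : (1 <= d)%N).

Let h : {poly 'F_p} := ('X - 1) ^+ d.

Lemma size_Xsub1_exp : size h = d.+1.
Proof. by rewrite /h -polyC1 size_exp_XsubC. Qed.

(** The ring [{poly %/ h}] is the quotient by [mk_monic h], which defaults to ['X] unless [h] is
    monic and nonconstant; [d_ge1] excludes the default. *)
Lemma mk_monic_Xsub1_exp : mk_monic h = h.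
Proof.
rewrite /mk_monic size_Xsub1_exp ltnS d_ge1 /= /h -polyC1.
by rewrite rpredX ?monicXsubC.
Qed.

Lemma eq_in_qpoly (P Q : {poly 'F_p}) :
  (in_qpoly h P == in_qpoly h Q) = (P %% h == Q %% h).
Proof.
have mon_h : h \is monic by rewrite -mk_monic_Xsub1_exp monic_mk_monic.
by rewrite -val_eqE /= mk_monic_Xsub1_exp !Pdiv.IdomainMonic.modpE.
Qed.

Lemma qbinomial_languageE (A : eqType) (c : 'F_p) (v : seq A) R :
  c != 0 -> qbinomial_language v R (c *: h) =
  [set u | in_qpoly h (qbinomialFp p u v) = in_qpoly h R].
Proof.
move=> c_neq0; apply/seteqP; split=> u /=;
  rewrite /qbinomial_language /= !modpZr //.
  by move/eqP; rewrite -eq_in_qpoly => /eqP.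
by move/eqP; rewrite eq_in_qpoly => /eqP.
Qed.

(** By Frobenius, ['X^(p ^ d) - 1] is [('X - 1) ^+ (p ^ d)], a multiple of [h] since
    [d <= p ^ d]. *)
Lemma in_qpolyX_exp_pchar : in_qpoly h 'X ^+ (p ^ d) = 1.
Proof.
have in_h : in_qpoly h h = 0.
  by apply/eqP; rewrite -(in_qpoly0 h) eq_in_qpoly modpp mod0p.
have pcharP : p \in [pchar {poly 'F_p}] by rewrite pchar_poly pchar_Fp.
have : in_qpoly h (('X - 1) ^+ (p ^ d)) = 0.
  have d_le : (d <= p ^ d)%N by rewrite ltnW // ltn_expl ?prime_gt1.
  by rewrite -(subnKC d_le) exprD rmorphM /= in_h mul0r.
rewrite exprDn_pchar ?exprNn_pchar ?expr1n; last 2 first.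
- by rewrite (eq_pnat _ (pcharf_eq pcharP)) pnatX pnat_id.
- by rewrite (eq_pnat _ (pcharf_eq pcharP)) pnatX pnat_id.
by rewrite rmorphB rmorph1 rmorphXn /= => /eqP; rewrite subr_eq0 => /eqP.
Qed.

Lemma qbinomial_p_group_function (A : choiceType) (v : seq A) :
  p_group_function p (fun u => in_qpoly h (qbinomialFp p u v)).
Proof.
elim/last_ind: v => [|v b IHv].
  have := p_group_function_cst A p (in_qpoly h 1).
  by congr p_group_function; apply/funext => u; rewrite qbinomialFpu0.
pose theta (x : {poly %/ h}) := in_qpoly h 'X ^+ size (rcons v b) * x.
apply: (@p_group_function_recursion A p {poly %/ h} _ theta d _ _
  (fun a x => (a == b)%:R * x) p_prime _ _ _ IHv).
- by move=> x y; apply: mulrDr.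
- move=> x; have : p \in [pchar {poly %/ h}] by rewrite pchar_qpoly pchar_Fp.
  by move/mulrn_pchar.
- move=> x; rewrite iter_mulr -exprM mulnC exprM in_qpolyX_exp_pchar.
  by rewrite expr1n mul1r.
by move=> u a; rewrite qbinomialFp_rcons rmorphD !rmorphM rmorphXn rmorph_nat.
Qed.

End Residues.

(** * Boolean combinations and saturated sets *)

Section BooleanCombinations.
Variables (T : Type) (F : set (set T)).

(** There is no nullary constructor: the empty set has to come from a member of [F] and its
    complement. *)
Lemma boolean_combination_set0 X : F X -> boolean_combination F set0.
Proof.
move=> FX; rewrite -(setICr X).
by apply: BoolComb_setI; [|apply: BoolComb_setC]; apply: BoolComb_base.
Qed.

Lemma boolean_combination_exists_seq (Y : eqType) (s : seq Y)
    (X : Y -> set T) :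
    boolean_combination F set0 -> (forall r, boolean_combination F (X r)) ->
  boolean_combination F [set u | exists2 r, r \in s & X r u].
Proof.
move=> F0 FX; elim: s => [|r s IHs].
  suff -> : [set u | exists2 r, r \in [::] & X r u] = set0 by [].
  by apply/seteqP; split=> u // [].
suff -> : [set u | exists2 r', r' \in r :: s & X r' u] =
    X r `|` [set u | exists2 r', r' \in s & X r' u] by apply: BoolComb_setU.
apply/seteqP; split=> u /=.
  by case=> r'; rewrite inE => /predU1P[-> | r's] Xu; [left | right; exists r'].
case=> [Xu|[r' r's Xu]]; first by exists r; rewrite ?mem_head.
by exists r'; rewrite ?inE ?r's ?orbT.
Qed.

(** Induction on [s]: [L] is cut along the finitely many fibres of [f i]; with no function left, it
    is empty or everything. *)
Lemma boolean_combination_saturated (I : eqType) (Y : finType) (f : I -> T -> Y)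
    (s : seq I) (L : set T) :
    boolean_combination F set0 ->
    (forall i r, F [set u | f i u = r]) ->
    (forall u u', {in s, forall i, f i u = f i u'} -> L u -> L u') ->
  boolean_combination F L.
Proof.
move=> F0 Ff; elim: s L => [|i s IHs] L satL.
  have [[u Lu]|L0] := pselect (exists u, L u).
    suff -> : L = ~` set0 by apply: BoolComb_setC.
    by apply/seteqP; split=> u' _; [case | apply: (satL u)].
  suff -> : L = set0 by [].
  by apply/seteqP; split=> u Lu //; case: L0; exists u.
(* [X r] is the slice of [L] over [r], saturated for the remaining functions; intersecting it with
   the fibre gives the slice back. *)
pose X r := [set u |
  exists2 u', L u' & f i u' = r /\ {in s, forall j, f j u' = f j u}].
suff -> : L = [set u | exists2 r, r \in enum Y &
    ([set v | f i v = r] `&` X r) u].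
  apply: boolean_combination_exists_seq => // r.
  apply: BoolComb_setI; first exact/BoolComb_base/Ff.
  apply: IHs => u1 u2 eq12 [u' Lu' [fu' eq'1]]; exists u' => //.
  split=> // j js.
  by rewrite eq'1 // eq12.
apply/seteqP; split=> u /=.
  by move=> Lu; exists (f i u); rewrite ?mem_enum //; split=> //; exists u.
case=> r _ [<- [u' Lu' [fu' eq'u]]]; apply: (satL u') => // j.
by rewrite inE => /predU1P[->|/eq'u].
Qed.

End BooleanCombinations.

(** * Nilpotence of the augmentation ideal of a [p]-group *)

Section Nilpotence.
Variables (F : fieldType) (p : nat) (gT : finGroupType) (G : {group gT}).
Hypotheses (pcharF : p \in [pchar F]) (pG : (p.-group G)%g).

(* By induction on the degree: a nonzero representation has a nonzero fixed
   subspace, and passing to the quotient by it costs one factor. *)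
Lemma pgroup_augmentation_nilpotent n (rG : mx_representation F G n) m
    (V : 'M_(m, n)) (hs : seq gT) :
    {subset hs <= G} -> (n <= size hs)%N ->
  foldl (fun W x => W *m rG x - W) V hs = 0.
Proof.
elim/ltn_ind: n => n IHn in rG V hs *.
case: (posnP n) => [n0 _ _ | n_gt0].
  by subst n; rewrite [LHS]thinmx0.
case/lastP: hs => [|hs x] sG; first by rewrite leqNgt n_gt0.
rewrite size_rcons => le_n; set U := rfix_mx rG G.
have modU : mxmodule rG U := rfix_mx_module rG.
have Gx : x \in G by apply: sG; rewrite mem_rcons mem_head.
have {}sG : {subset hs <= G}.
  by move=> y hy; apply: sG; rewrite mem_rcons inE hy orbT.
have lt_n : (\rank (cokermx U) < n)%N.
  rewrite mxrank_coker ltn_subrL n_gt0 lt0n mxrank_eq0 andbT.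
  by rewrite (rfix_pgroup_pchar pcharF rG n_gt0 pG).
have in_foldl ys (W : 'M_(m, n)) : {subset ys <= G} ->
    in_factmod U (foldl (fun W x => W *m rG x - W) W ys) =
    foldl (fun W x => W *m factmod_repr modU x - W) (in_factmod U W) ys.
  elim: ys W => //= y ys IHys W sysG.
  rewrite IHys; last by move=> z zs; apply: sysG; rewrite inE zs orbT.
  by rewrite linearB /= in_factmodJ // sysG // mem_head.
(* By induction on the quotient by [U], the earlier factors already send [V] into [U], where [x]
   acts trivially. *)
rewrite foldl_rcons; set W := foldl _ _ _.
suff /rfix_mxP-> : (W <= U)%MS by rewrite ?subrr.
rewrite -in_factmod_eq0 in_foldl // IHn //.
by rewrite -ltnS (leq_trans lt_n).
Qed.

End Nilpotence.

(** * Newton interpolation on words *)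

Section Newton.
Variables (A : finType) (p : nat).
Hypothesis p_prime : prime p.

(** At [q = 1] the coefficients are the ordinary binomials of words modulo [p]. *)
Definition binomial_combination (f : seq A -> 'F_p) :=
  exists s : seq ('F_p * seq A),
    forall u, f u = \sum_(x <- s) x.1 * (qbinomialFp p u x.2).[1].

(* Newton's interpolation formula: a discrete primitive of [u |-> binom(u, v)]
   in the direction [a] is [u |-> binom(u, va)]. *)
Lemma binomial_combination_primitive (f : seq A -> 'F_p) :
    (forall a, binomial_combination (fun u => f (rcons u a) - f u)) ->
  binomial_combination f.
Proof.
move=> /choice[s sE].
(* The constant of integration [f [::]], then a primitive of each difference, obtained by appending
   [a] to its words. *)
exists ((f [::], [::]) ::
  flatten [seq [seq (x.1, rcons x.2 a) | x <- s a] | a <- enum A]) => u.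
rewrite big_cons qbinomialFpu0 hornerC mulr1 big_flatten /= big_map big_enum /=.
under eq_bigr do rewrite big_map /=.
elim/last_ind: u => [|u b IHu].
  rewrite big1 ?addr0 // => a _; rewrite big1 // => x _.
  by rewrite qbinomialFp0v ?horner0 ?mulr0 // -size_eq0 size_rcons.
rewrite -[LHS](subrK (f u)) sE [in LHS]IHu addrCA; congr (_ + _).
transitivity (\sum_a (\sum_(x <- s a) x.1 * (qbinomialFp p u (rcons x.2 a)).[1]
    + (a == b)%:R * \sum_(x <- s a) x.1 * (qbinomialFp p u x.2).[1])).
  rewrite big_split /= addrC; congr (_ + _).
  rewrite (bigD1 b) //= eqxx mul1r [X in _ + X]big1 ?addr0 // => a /negPf->.
  by rewrite mul0r.
apply: eq_bigr => a _; rewrite mulr_sumr -big_split; apply: eq_bigr => x _.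
rewrite qbinomialFp_rcons hornerD !hornerM hornerXn expr1n mul1r.
rewrite -polyC_natr hornerC mulrDr eq_sym; congr (_ + _).
by rewrite mulrCA.
Qed.

Lemma p_group_binomial_combination (gT : finGroupType) (mu : seq A -> gT)
    (phi : gT -> 'F_p) :
    (p.-group [set: gT]%G)%g -> monoid.monoid_morphism mu ->
  binomial_combination (phi \o mu).
Proof.
move=> pG muM; set aG := regular_repr 'F_p [set: gT]%G.
set n := gcard [set: gT]%G in aG *.
have {muM} muE u a : aG (mu (rcons u a)) = aG (mu u) *m aG (mu [:: a]).
  by rewrite -cats1 muM repr_mxM ?inE.
(* Differencing in the direction [a] replaces [y] by [(aG (mu [:: a]) - 1) y], which is killed by
   one factor fewer. *)
have combination k (w : 'rV_n) (y : 'cV_n) :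
    (forall (W : 'M_n) hs, size hs = k ->
       foldl (fun W x => W *m aG x - W) W hs *m y = 0) ->
    binomial_combination (fun u => (w *m aG (mu u) *m y) 0 0).
  elim: k y => [|k IHk] y y0.
    exists [::] => u; rewrite big_nil.
    have /= := y0 1%:M [::] (erefl _); rewrite mul1mx => ->.
    by rewrite mulmx0 mxE.
  apply: binomial_combination_primitive => a.
  have [|s sE] := IHk ((aG (mu [:: a]) - 1%:M) *m y).
    move=> W hs hs_k; rewrite mulmxA mulmxBr mulmx1.
    have := y0 W (rcons hs (mu [:: a])).
    by rewrite foldl_rcons size_rcons hs_k; apply.
  exists s => u; rewrite -sE muE !mulmxA mulmxBr mulmx1 mulmxBl.
  by rewrite [RHS]mxE [X in _ = _ + X]mxE.
(* [w] is the basis vector of the identity, so [w *m aG g] is that of [g], and pairing it with [y]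
   reads off [phi g]. *)
pose w : 'rV['F_p]_n := delta_mx 0 (gring_index [set: gT]%G 1%g).
pose y : 'cV['F_p]_n := \col_i phi (enum_val i).
have [|s sE] := combination n w y.
  move=> W hs hs_k; rewrite (pgroup_augmentation_nilpotent _ pG) ?mul0mx //.
  - exact: pchar_Fp.
  - by move=> x; rewrite inE.
  - by rewrite hs_k.
exists s => u; rewrite -sE /w -rowE rowK gring_indexK ?inE // mul1g -rowE.
by rewrite !mxE gring_indexK ?inE.
Qed.

End Newton.

(** * The two implications *)

Lemma p_group_language_boolean_combination (A : choiceType) (p : nat)
    (F : set (set (seq A))) (L : set (seq A)) :
    (forall K, F K -> p_group_language p K) ->
  boolean_combination F L -> p_group_language p L.
Proof.
move=> FP; elim=> {L} [K /FP//|K1 K2 _ IH1 _ IH2|K1 K2 _ IH1 _ IH2|K _ IH].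
- move: IH1 IH2; rewrite !p_group_languageE => IH1 IH2.
  exact: (p_group_function_comp (fun P => P.1 \/ P.2)
    (p_group_function_pair IH1 IH2)).
- move: IH1 IH2; rewrite !p_group_languageE => IH1 IH2.
  exact: (p_group_function_comp (fun P => P.1 /\ P.2)
    (p_group_function_pair IH1 IH2)).
- move: IH; rewrite !p_group_languageE => IH.
  exact: (p_group_function_comp not IH).
Qed.

(** As [d >= 1], the modulus vanishes at [1], so reduction preserves the value there. *)
Lemma in_qpoly_horner1 (p d : nat) (P Q : {poly 'F_p}) :
    (1 <= d)%N ->
    in_qpoly (('X - 1) ^+ d) P = in_qpoly (('X - 1) ^+ d) Q -> P.[1] = Q.[1].
Proof.
move=> d_ge1 /eqP; rewrite eq_in_qpoly // => /eqP eqPQ.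
have h1 (S : {poly 'F_p}) : S.[1] = (S %% ('X - 1) ^+ d).[1].
  rewrite [in LHS](divp_eq S (('X - 1) ^+ d)) hornerD hornerM horner_exp.
  by rewrite hornerD hornerX hornerN hornerC subrr expr0n gtn_eqF //
    mulr0 add0r.
by rewrite h1 eqPQ -h1.
Qed.

Unset Implicit Arguments.

Theorem theorem6p18 (A : finType) (p : nat) (p_prime : prime p)
    (a : 'F_p) (a_neq0 : a != 0) (d : nat) (d_ge1 : (1 <= d)%N)
    (M : {poly 'F_p}) (M_def : M = a *: ('X - 1) ^+ d) (L : set (seq A)) :
  p_group_language p L <->
  boolean_combination
    [set K : set (seq A) | exists (v : seq A) (R : {poly 'F_p}),
       (size R < size M)%N /\ K = qbinomial_language v R M] L.
Proof.
set F := [set K | _].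
have sizeM : size M = d.+1 by rewrite M_def size_scale // size_Xsub1_exp.
pose h : {poly 'F_p} := ('X - 1) ^+ d.
pose f (v u : seq A) := in_qpoly h (qbinomialFp p u v).
split; last first.
  apply: p_group_language_boolean_combination => _ [v [R [_ ->]]].
  rewrite M_def qbinomial_languageE //; apply/p_group_languageE.
  exact: (p_group_function_comp (fun x => x = in_qpoly h R)
    (qbinomial_p_group_function p_prime d_ge1 v)).
(* The canonical representative of [r] satisfies the degree bound imposed on [R]. *)
have F_fiber v (r : {poly %/ h}) : F [set u | f v u = r].
  exists v, r; split.
    rewrite sizeM -(size_Xsub1_exp p d) -(mk_monic_Xsub1_exp p d_ge1).
    exact: size_mk_monic.
  rewrite M_def qbinomial_languageE //.
  suff -> : in_qpoly h r = r by [].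
  by apply: val_inj; apply: in_qpoly_small; apply: size_mk_monic.
case=> gT [pG [mu [S [muM ->]]]].
(* The indicator of [S] is a combination of binomials at [q = 1], so the residues for the words in
   [s] decide membership. *)
pose phi x : 'F_p := `[< S x >]%:R.
have [s sE] := p_group_binomial_combination p_prime phi pG muM.
apply: (@boolean_combination_saturated _ _ _ _ f [seq x.2 | x <- s]) => //.
  exact: boolean_combination_set0 (F_fiber [::] 0).
move=> u u' eq_uu' /= Su; apply/asboolP; apply: contraT => notSu'.
suff : phi (mu u) = phi (mu u').
  by rewrite /phi asboolT // (negPf notSu') => /eqP; rewrite oner_eq0.
rewrite -[LHS]/((phi \o mu) u) -[RHS]/((phi \o mu) u') !sE.
apply: eq_big_seq => x xs; congr (_ * _).
by apply: (in_qpoly_horner1 d_ge1); apply: eq_uu'; apply: map_f.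
Qed.
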